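(* Let $G=(V,E)$ be a graph which is an $n$-convex geometry. The following facts are equivalent: (i) $G$ is quasi-threshold; (ii) $G$ is isomorphic to one of $K_1$, $2K_1$, $P_3$; (iii) $G$ is threshold. In particular, if $|V|\geq 4$, then $G$ admits an induced subgraph isomorphic to $P_4$ or an induced subgraph isomorphic to $C_4$.
   Context: All graphs are finite, simple and undirected, with non-empty vertex set. $K_1$ is the one-vertex graph, $2K_1$ the graph on two vertices with no edge, $2K_2$ the disjoint union of two edges, $P_k$ the path on $k$ vertices, $C_k$ the cycle on $k$ vertices. A graph is quasi-threshold if it has no induced subgraph isomorphic to $P_4$ or $C_4$; it is threshold if it has no induced subgraph isomorphic to $P_4$, $C_4$ or $2K_2$. For a graph $G=(V,E)$ and $x\in V$, the closed neighbourhood of $x$ is $N[x]=\{x\}\cup\{y\in V:\{x,y\}\in E\}$. For $Y\subseteq V$, the common closed neighbourhood is $N[Y]=\bigcap_{y\in Y}N[y]$ if $Y\neq\varnothing$, and $N[\varnothing]=V$. The neighbourhood convexity of $G$ is the family $n_G=\{N[Y]:Y\subseteq V\}\cup\{\varnothing\}$ of subsets of $V$; it contains $\varnothing$ and $V$ and is closed under intersection. Its members are called $n$-convex sets. For $X\subseteq V$ the convex hull $[X]_{n}$ is the intersection of all $n$-convex sets containing $X$. For an $n$-convex set $K$, $\operatorname{ex}(K)=\{x\in K: K\setminus\{x\}\in n_G\}$ is the set of extreme points of $K$. $G$ is an $n$-convex geometry if $K=[\operatorname{ex}(K)]_{n}$ for every $n$-convex set $K$. *)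

(* Defs.v *)
From mathcomp Require Import all_boot.

Set Implicit Arguments.
Unset Strict Implicit.
Unset Printing Implicit Defensive.

(* The empty graph is allowed here; non-emptiness of the vertex set is an
   explicit hypothesis where it is needed. *)
Record sgraph := SGraph {
  vertex :> finType;
  edge : rel vertex;
  edge_sym : symmetric edge;
  edge_irrefl : irreflexive edge }.

Definition isomorphic (G H : sgraph) : Prop :=
  exists2 f : G -> H, bijective f & forall x y, edge (f x) (f y) = edge x y.

Section Induced.
Variables (G : sgraph) (S : {set G}).

Definition induced_edge : rel {x : G | x \in S} :=
  fun u v => edge (val u) (val v).

Lemma induced_edge_sym : symmetric induced_edge.
Proof. by move=> u v; apply: edge_sym. Qed.

Lemma induced_edge_irrefl : irreflexive induced_edge.
Proof. by move=> u; apply: edge_irrefl. Qed.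

Definition induced : sgraph := SGraph induced_edge_sym induced_edge_irrefl.
End Induced.

Definition has_induced (H G : sgraph) : Prop :=
  exists S : {set G}, isomorphic (induced S) H.

Section StandardGraphs.
Variable n : nat.

Definition complete_edge : rel 'I_n := fun i j => i != j.

Lemma complete_edge_sym : symmetric complete_edge.
Proof. by move=> i j; rewrite /complete_edge eq_sym. Qed.

Lemma complete_edge_irrefl : irreflexive complete_edge.
Proof. by move=> i; rewrite /complete_edge eqxx. Qed.

Definition complete_graph : sgraph :=
  SGraph complete_edge_sym complete_edge_irrefl.

Definition edgeless_edge : rel 'I_n := fun _ _ => false.

Lemma edgeless_edge_sym : symmetric edgeless_edge.
Proof. by []. Qed.

Lemma edgeless_edge_irrefl : irreflexive edgeless_edge.
Proof. by []. Qed.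

Definition edgeless_graph : sgraph :=
  SGraph edgeless_edge_sym edgeless_edge_irrefl.

Definition path_edge : rel 'I_n :=
  fun i j => (i.+1 == j :> nat) || (j.+1 == i :> nat).

Lemma path_edge_sym : symmetric path_edge.
Proof. by move=> i j; rewrite /path_edge orbC. Qed.

Lemma path_edge_irrefl : irreflexive path_edge.
Proof. by move=> i; rewrite /path_edge orbb gtn_eqF. Qed.

Definition path_graph : sgraph := SGraph path_edge_sym path_edge_irrefl.

(* This is the n-cycle for n >= 3 only; [i != j] matters only for n = 1. *)
Definition cycle_edge : rel 'I_n :=
  fun i j => (i != j) && ((j == ordS i) || (i == ordS j)).

Lemma cycle_edge_sym : symmetric cycle_edge.
Proof. by move=> i j; rewrite /cycle_edge eq_sym orbC. Qed.

Lemma cycle_edge_irrefl : irreflexive cycle_edge.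
Proof. by move=> i; rewrite /cycle_edge eqxx. Qed.

Definition cycle_graph : sgraph := SGraph cycle_edge_sym cycle_edge_irrefl.
End StandardGraphs.

Section DisjointUnion.
Variables G H : sgraph.

Definition union_edge : rel (G + H)%type := fun u v =>
  match u, v with
  | inl x, inl y => edge x y
  | inr x, inr y => edge x y
  | _, _ => false
  end.

Lemma union_edge_sym : symmetric union_edge.
Proof. by move=> [x|x] [y|y] //=; apply: edge_sym. Qed.

Lemma union_edge_irrefl : irreflexive union_edge.
Proof. by move=> [x|x] /=; apply: edge_irrefl. Qed.

Definition disjoint_union : sgraph :=
  SGraph union_edge_sym union_edge_irrefl.
End DisjointUnion.

Definition K1 : sgraph := complete_graph 1.
Definition twoK1 : sgraph := edgeless_graph 2.
Definition twoK2 : sgraph :=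
  disjoint_union (complete_graph 2) (complete_graph 2).
Definition P3 : sgraph := path_graph 3.
Definition P4 : sgraph := path_graph 4.
Definition C4 : sgraph := cycle_graph 4.

Definition quasi_threshold (G : sgraph) : Prop :=
  ~ has_induced P4 G /\ ~ has_induced C4 G.

Definition threshold (G : sgraph) : Prop :=
  [/\ ~ has_induced P4 G, ~ has_induced C4 G & ~ has_induced twoK2 G].

Section NeighbourhoodConvexity.
Variable G : sgraph.
Implicit Types (x : G) (X Y K : {set G}).

Definition closed_nbh x : {set G} := x |: [set y | edge x y].

(* For [Y = set0] the empty intersection is the full vertex set. *)
Definition common_closed_nbh Y : {set G} := \bigcap_(y in Y) closed_nbh y.

Definition n_convexity : {set {set G}} :=
  set0 |: [set common_closed_nbh Y | Y : {set G}].

Definition n_hull X : {set G} := \bigcap_(K in n_convexity | X \subset K) K.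

Definition extreme_points K : {set G} :=
  [set x in K | K :\ x \in n_convexity].
End NeighbourhoodConvexity.

Definition n_convex_geometry (G : sgraph) : Prop :=
  forall K : {set G}, K \in n_convexity G -> K = n_hull (extreme_points K).

(* Main.v *)
Require Import Defs.
From mathcomp Require Import all_boot.

Set Implicit Arguments.
Unset Strict Implicit.
Unset Printing Implicit Defensive.

(** In a geometry on at least two vertices, an extreme point x of V comes with a
    vertex y whose only non-neighbour is x. Since N[x] is convex and misses y,
    the point x alone does not span V, so there is a second such pair (x', y').
    If the two pairs are different as sets, x - y' - y - x' induces a P4 or a C4
    according to whether x and x' are adjacent. Otherwise x and y are each
    other's only non-neighbour, and the remaining vertices form a clique, or
    else there is an induced C4. They are then all universal, and the convex set
    of universal vertices of a geometry has at most one element. *)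

(** * Isomorphisms and induced subgraphs from embeddings *)

Lemma isomorphic_of_embedding (G H : sgraph) (f : H -> G) :
  injective f -> (forall x y, edge (f x) (f y) = edge x y) ->
  #|G| <= #|H| -> isomorphic G H.
Proof.
(* The bound on the vertex counts makes [f] bijective; [isomorphic G H] asks for a map out of [G],
   so its inverse is used. *)
move=> f_inj f_edge leGH; have [g fK gK] := inj_card_bij f_inj leGH.
by exists g => [|x y]; [exists f | rewrite -f_edge !gK].
Qed.

Lemma has_induced_of_embedding (G H : sgraph) (f : H -> G) :
  injective f -> (forall x y, edge (f x) (f y) = edge x y) -> has_induced H G.
Proof.
move=> f_inj f_edge; exists [set f x | x in H].
have f_im x : f x \in [set f x | x in H] by apply: imset_f.
pose g x : induced [set f x | x in H] := exist _ (f x) (f_im x).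
apply: (@isomorphic_of_embedding _ _ g) => [x y [/f_inj]//|x y|].
  exact: f_edge.
rewrite card_sig -(card_imset _ f_inj).
by apply: subset_leq_card; apply/subsetP.
Qed.

Lemma isomorphic_card (G H : sgraph) : isomorphic G H -> #|G| = #|H|.
Proof. by case=> f /bij_eq_card. Qed.

Lemma has_induced_card (G H : sgraph) : has_induced H G -> #|H| <= #|G|.
Proof. by case=> S /isomorphic_card <-; rewrite card_sig max_card. Qed.

Lemma nth_ord_inj (T : eqType) (x0 : T) (s : seq T) n :
  size s = n -> uniq s -> injective (fun i : 'I_n => nth x0 s i).
Proof.
move=> <- s_uniq i j /eqP; rewrite nth_uniq // => /eqP; exact: val_inj.
Qed.

Section FourVertices.
Variables (G : sgraph) (a b c d : G).
Hypotheses (abcd_uniq : uniq [:: a; b; c; d])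
  (ab : edge a b) (bc : edge b c) (cd : edge c d)
  (ac : edge a c = false) (bd : edge b d = false).

Lemma has_induced_P4 : edge a d = false -> has_induced P4 G.
Proof.
move=> ad; pose f (i : P4) := nth a [:: a; b; c; d] i.
apply: (@has_induced_of_embedding _ _ f); first exact: nth_ord_inj.
(* All sixteen pairs of indices are checked; pairs in decreasing order reduce to the hypotheses by
   symmetry. *)
by do 2!case=> [[|[|[|[|//]]]] ?]; rewrite /f /= ?edge_irrefl //;
  rewrite // edge_sym.
Qed.

Lemma has_induced_C4 : edge a d -> has_induced C4 G.
Proof.
move=> ad; pose f (i : C4) := nth a [:: a; b; c; d] i.
apply: (@has_induced_of_embedding _ _ f); first exact: nth_ord_inj.
by do 2!case=> [[|[|[|[|//]]]] ?]; rewrite /f /= ?edge_irrefl //;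
  rewrite // edge_sym.
Qed.

End FourVertices.

(** * Convex sets, universal vertices and extreme points *)

Section Geometry.
Variable G : sgraph.
Implicit Types (x y z w : G) (K : {set G}).

Lemma in_closed_nbh x y : (y \in closed_nbh x) = (y == x) || edge x y.
Proof. by rewrite !inE. Qed.

Lemma n_convexityP K :
  reflect (K = set0 \/ exists Y, K = common_closed_nbh Y) (K \in n_convexity G).
Proof.
rewrite !inE; apply: (iffP orP) => [[/eqP|/imsetP[Y _]]|[/eqP|[Y ->]]] //.
- by left.
- by right; exists Y.
- by left.
- by right; apply: imset_f.
Qed.

Lemma n_convexity0 : set0 \in n_convexity G.
Proof. by apply/n_convexityP; left. Qed.

Lemma common_closed_nbh_convex (Y : {set G}) :
  common_closed_nbh Y \in n_convexity G.
Proof. by apply/n_convexityP; right; exists Y. Qed.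

Lemma n_convexityT : setT \in n_convexity G.
Proof.
by rewrite -(_ : common_closed_nbh set0 = setT) ?common_closed_nbh_convex //
  /common_closed_nbh big_set0.
Qed.

Lemma closed_nbh_convex x : closed_nbh x \in n_convexity G.
Proof.
rewrite -(_ : common_closed_nbh [set x] = closed_nbh x).
  exact: common_closed_nbh_convex.
by rewrite /common_closed_nbh big_set1.
Qed.

Lemma n_hull_min (X K : {set G}) :
  K \in n_convexity G -> X \subset K -> n_hull X \subset K.
Proof. by move=> convK sXK; apply: bigcap_inf; rewrite convK. Qed.

Lemma n_hull0 : n_hull set0 = set0 :> {set G}.
Proof. by apply/eqP; rewrite -subset0 n_hull_min ?n_convexity0. Qed.

Hypothesis G_geom : n_convex_geometry G.

(** Every $N[Y]$ contains all universal vertices, so the set $K = N[V]$ of these loses convexity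
    when one of them is removed, unless nothing remains. With two universal vertices $K$ would have
    no extreme point and would equal the hull of the empty set, which is empty. *)
Lemma universal_unique w w' :
  closed_nbh w = setT -> closed_nbh w' = setT -> w = w'.
Proof.
have univ_in v (Y : {set G}) :
    closed_nbh v = setT -> v \in common_closed_nbh Y.
  move=> vT; apply/bigcapP => z _; rewrite in_closed_nbh eq_sym edge_sym.
  by rewrite -in_closed_nbh vT inE.
move=> wT w'T; apply/eqP; apply: contraT => ww'.
pose K : {set G} := common_closed_nbh setT.
have K_univ e : e \in K -> closed_nbh e = setT.
  move/bigcapP=> eK; apply/setP=> z; rewrite in_setT in_closed_nbh.
  by rewrite eq_sym edge_sym -in_closed_nbh eK.
suff ex0 : extreme_points K = set0.
  have K_conv : K \in n_convexity G by apply: common_closed_nbh_convex.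
  have : w \in K by apply: univ_in.
  by rewrite (G_geom K_conv) ex0 n_hull0 inE.
apply/setP=> e; rewrite [RHS]inE inE.
apply/negP=> /andP[eK /n_convexityP[K0|[Y KY]]].
  have: (w \in K :\ e) || (w' \in K :\ e).
    rewrite !in_setD1 !(univ_in _ _ _) // !andbT.
    by case: (eqVneq w e) => //= <-; rewrite eq_sym.
  by rewrite K0 !inE.
by have := univ_in e Y (K_univ _ eK); rewrite -KY !inE eqxx.
Qed.

(** Since $V \setminus \{x\}$ is convex and non-empty, it is some $N[Y]$. A vertex $y \in Y$ with $x
    \notin N[y]$ then satisfies $V \setminus \{x\} = N[Y] \subseteq N[y]$, which leaves no choice
    for $N[y]$. *)
Lemma extreme_setT x :
  1 < #|G| -> x \in extreme_points [set: G] ->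
  exists y, closed_nbh y = ~: [set x].
Proof.
move=> G_gt1; rewrite inE setTD => /andP[_ /n_convexityP[x0|[Y xY]]].
  by have := cardsC1 x; rewrite x0 cards0 -subn1 => /esym/eqP;
     rewrite subn_eq0 leqNgt G_gt1.
have /exists_inP[y yY xy] : [exists y in Y, x \notin closed_nbh y].
  have: x \notin common_closed_nbh Y by rewrite -xY !inE eqxx.
  apply: contraR; rewrite negb_exists_in => /forall_inP x_nbh.
  by apply/bigcapP => y /x_nbh; rewrite negbK.
exists y; apply/eqP; rewrite eqEsubset subsetC sub1set inE xy /= xY.
exact: bigcap_inf.
Qed.

Lemma two_extreme_setT : 1 < #|G| ->
  exists x y x' y',
    [/\ x != x', closed_nbh y = ~: [set x] & closed_nbh y' = ~: [set x']].
Proof.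
move=> G_gt1.
have spanT := G_geom n_convexityT.
have ex_neq0 : extreme_points [set: G] != set0.
  apply: contraTneq G_gt1 => ex0.
  by rewrite -cardsT spanT ex0 n_hull0 cards0.
have [x x_ex] := set0Pn _ ex_neq0.
have [y yx] := extreme_setT G_gt1 x_ex.
have x_y : x \notin closed_nbh y by rewrite yx !inE eqxx.
(* Were [x] the only extreme point, the convex set $N[x]$ would contain the hull of the extreme
   points, that is $V$, and hence [y]. *)
have /subsetPn[x' x'_ex x'x] : ~~ (extreme_points [set: G] \subset [set x]).
  apply: contraNN x_y => ex_sub.
  rewrite in_closed_nbh eq_sym edge_sym -in_closed_nbh.
  have: y \in [set: G] by rewrite inE.
  rewrite spanT; apply/subsetP/n_hull_min; first exact: closed_nbh_convex.
  by apply: subset_trans ex_sub _; rewrite sub1set in_closed_nbh eqxx.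
have [y' y'x'] := extreme_setT G_gt1 x'_ex.
by exists x, y, x', y'; split=> //; rewrite eq_sym -in_set1.
Qed.

Lemma only_non_nbhP x y :
  closed_nbh y = ~: [set x] ->
  x != y /\ forall z, edge y z = (z != x) && (z != y).
Proof.
move/setP=> yx; split=> [|z].
  by have := yx y; rewrite in_closed_nbh !inE eqxx eq_sym /= => <-.
have := yx z; rewrite in_closed_nbh !inE.
by case: eqP => [->|_ /= ->]; rewrite ?edge_irrefl ?andbF ?andbT.
Qed.

(** * Classification of the geometries on at least two vertices *)

Lemma n_convex_geometry_cases : 1 < #|G| ->
  [\/ has_induced P4 G, has_induced C4 G, isomorphic G twoK1
    | isomorphic G P3].
Proof.
move=> G_gt1; have [x [y [x' [y' [xx' yx y'x']]]]] := two_extreme_setT G_gt1.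
have [xy y_nbh] := only_non_nbhP yx.
have [x'y' y'_nbh] := only_non_nbhP y'x'.
have yy' : y != y'.
  apply: contraNneq xx' => y_y'; move: yx; rewrite y_y' y'x' => /setP/(_ x).
  by rewrite !inE eqxx => /negbFE.
(* If [x] differs from [y'], then [y] and [y'] are adjacent, which in turn forces [x'] to differ
   from [y]: the four vertices are distinct. *)
have [xy'|x_y'] := eqVneq x y'; last first.
  have x'_y : x' != y.
    apply/eqP => x'y; have := edge_sym y y'.
    by rewrite y_nbh y'_nbh x'y eqxx (eq_sym y') x_y' (eq_sym y') yy'.
  have P_uniq : uniq [:: x; y'; y; x'].
    by rewrite /= !inE !negb_or x_y' xy xx' (eq_sym y') yy'
      (eq_sym y') x'y' (eq_sym y) x'_y.
  have xy'_edge : edge x y' by rewrite edge_sym y'_nbh xx' x_y'.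
  have y'y_edge : edge y' y by rewrite y'_nbh yy' eq_sym x'_y.
  have yx'_edge : edge y x' by rewrite y_nbh eq_sym xx' x'_y.
  have xy_nedge : edge x y = false by rewrite edge_sym y_nbh eqxx.
  have y'x'_nedge : edge y' x' = false by rewrite y'_nbh eqxx.
  case xx'_edge: (edge x x'); [apply: Or42 | apply: Or41].
    exact: (@has_induced_C4 _ x y' y x').
  exact: (@has_induced_P4 _ x y' y x').
(* The only non-neighbour of [y] is now [y'], so by symmetry [y] is the only non-neighbour of
   [y']. *)
have x_y : x' = y.
  apply/eqP; apply: contraTT (eqxx y) => x'_y.
  have := edge_sym y y'.
  by rewrite y_nbh y'_nbh -xy' eqxx /= eq_sym x'_y eq_sym xy.
have x_nbh z : edge x z = (z != x) && (z != y).
  by rewrite {1}xy' y'_nbh x_y -xy' andbC.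
(* Both [x] and [y] are adjacent to every other vertex, so two non-adjacent vertices [w], [w'] among
   the others close a $C_4$ in the order [x], [w], [y], [w']. *)
have [/existsP[[w w'] /= /and4P[]]|no_pair] :=
    boolP [exists p : G * G, [&& p.1 != p.2, ~~ edge p.1 p.2,
      edge x p.1 & edge x p.2]].
  move=> ww' ww'_nedge xw xw'; apply: Or42.
  have [yw yw'] : edge y w /\ edge y w' by rewrite !y_nbh -!x_nbh.
  have [/andP[w_x w_y] /andP[w'_x w'_y]] :
    ((w != x) && (w != y)) /\ ((w' != x) && (w' != y)) by rewrite -!x_nbh.
  apply: (@has_induced_C4 _ x w y w') => //.
  - by rewrite /= !inE !negb_or xy (eq_sym x) w_x (eq_sym x) w'_x w_y ww'
      (eq_sym y) w'_y.
  - by rewrite edge_sym.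
  - by rewrite x_nbh eqxx andbF.
  - exact: negbTE.
have univ w : edge x w -> closed_nbh w = setT.
  move=> xw; apply/setP=> z; rewrite in_closed_nbh inE.
  have yw : edge y w by rewrite y_nbh -x_nbh.
  have [-> | z_x] := eqVneq z x; first by rewrite (edge_sym w) xw orbT.
  have [-> | z_y] := eqVneq z y; first by rewrite (edge_sym w) yw orbT.
  apply: contraR no_pair; rewrite negb_or => /andP[z_w wz].
  by apply/existsP; exists (w, z); rewrite /= eq_sym z_w wz xw x_nbh z_x.
(* A neighbour [w] of [x] is universal, hence the only vertex besides [x] and [y], and the graph is
   $P_3$ with middle [w]; without neighbours of [x] only $2K_1$ remains. *)
have [w xw|no_w] := pickP (edge x).
  apply: Or44; pose f (i : P3) := nth x [:: x; w; y] i.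
  have yw : edge y w by rewrite y_nbh -x_nbh.
  have /andP[w_x w_y] : (w != x) && (w != y) by rewrite -x_nbh.
  apply: (@isomorphic_of_embedding _ _ f).
  - by apply: nth_ord_inj; rewrite //= !inE negb_or eq_sym w_x xy w_y.
  - by do 2!case=> [[|[|[|//]]] ?];
      rewrite /f /= ?edge_irrefl // ?x_nbh ?y_nbh ?eqxx ?andbF //;
      rewrite ?w_x ?w_y // edge_sym.
  - rewrite card_ord -cardsT -(_ : [set:: [:: x; w; y]] = setT).
      by rewrite cardsE; apply: card_size.
    apply/setP=> z; rewrite !inE; have [//|z_x] := eqVneq z x.
    have [_|z_y] := eqVneq z y; first by rewrite !orbT.
    have xz : edge x z by rewrite x_nbh z_x.
    by rewrite (universal_unique (univ _ xz) (univ _ xw)) eqxx.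
apply: Or43; pose f (i : twoK1) := nth x [:: x; y] i.
apply: (@isomorphic_of_embedding _ _ f).
- by apply: nth_ord_inj; rewrite //= !inE xy.
- by do 2!case=> [[|[|//]] ?];
    rewrite /f /= ?edge_irrefl // ?x_nbh ?y_nbh ?eqxx ?andbF.
- rewrite card_ord -cardsT -(_ : [set:: [:: x; y]] = setT).
    by rewrite cardsE; apply: card_size.
  by apply/setP=> z; rewrite !inE -[_ || _]negbK negb_or -x_nbh no_w.
Qed.
End Geometry.

(** * Small graphs and the equivalences *)

Lemma isomorphic_K1 (G : sgraph) : #|G| = 1 -> isomorphic G K1.
Proof.
move=> G1; have [x _] : {x : G | true}.
  by case: (pickP [pred x : G | true]) => [x|/eq_card0 G0];
    [exists x | rewrite G0 in G1].
apply: (@isomorphic_of_embedding _ _ (fun=> x)) => [i j _|i j|].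
- by rewrite !ord1.
- by rewrite !ord1 !edge_irrefl.
- by rewrite G1 card_ord.
Qed.

(** Each of the three forbidden subgraphs has four vertices. *)
Lemma threshold_of_card_le3 (G : sgraph) : #|G| <= 3 -> threshold G.
Proof.
move=> G_le3.
suff no_ind (H : sgraph) : 3 < #|H| -> ~ has_induced H G.
  by split; apply: no_ind; rewrite ?card_sum !card_ord.
move=> H_gt3 /has_induced_card; rewrite leqNgt.
by rewrite (leq_ltn_trans G_le3 H_gt3).
Qed.

Theorem theorem44 (G : sgraph) (G_nonempty : 0 < #|G|)
    (G_geom : n_convex_geometry G) :
  [<-> quasi_threshold G;
       [\/ isomorphic G K1, isomorphic G twoK1 | isomorphic G P3];
       threshold G]
  /\ (4 <= #|G| -> has_induced P4 G \/ has_induced C4 G).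
Proof.
have small : [\/ isomorphic G K1, isomorphic G twoK1 | isomorphic G P3] ->
    #|G| <= 3.
  by case=> /isomorphic_card ->; rewrite card_ord.
split; last first.
  move=> G_ge4; case: (n_convex_geometry_cases G_geom (ltn_trans _ G_ge4)) => //.
  - by left.
  - by right.
  - by move=> iso; have := small (Or32 _ _ iso); rewrite leqNgt G_ge4.
  - by move=> iso; have := small (Or33 _ _ iso); rewrite leqNgt G_ge4.
tfae.
(* The one-vertex graph is split off because the classification starts at two vertices. *)
- move=> [noP4 noC4]; move: G_nonempty; rewrite leq_eqVlt => /predU1P[G1|G_gt1].
    by apply/Or31/isomorphic_K1.
  by case: (n_convex_geometry_cases G_geom G_gt1) => // iso;
    [apply: Or32 | apply: Or33].
- by move/small; apply: threshold_of_card_le3.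
- by case.
Qed.
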